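(* Let $k\ge2$ be an integer. Then: 1) for every $\varepsilon>0$ there exists a positive integer $r(\varepsilon)$ such that for every integer $r\ge r(\varepsilon)$ and every integer $\gamma$ with $1\le\gamma\le r$, $$\left|\rho_r(P_{k,\gamma})-\frac{1}{\gamma^k\zeta(k)}\right|\le\frac{\varepsilon}{\gamma^{k-1}};$$ 2) as $r\to\infty$, $\rho_r(P_{k,\gamma})$ converges to $\frac{1}{\gamma^k\zeta(k)}$ uniformly in $\gamma\in\{1,2,3,\dots\}$.
   Context: For an integer $\gamma\ge1$, $P_{k,\gamma}$ is the set of $\gamma$-primitive elements of $\mathbb{Z}^k$: the nonzero tuples $(\gamma_1,\dots,\gamma_k)\in\mathbb{Z}^k$ with $\gcd(\gamma_1,\dots,\gamma_k)=\gamma$. For a nonnegative integer $r$, $B_r=\{(\gamma_1,\dots,\gamma_k)\in\mathbb{Z}^k:\max_i|\gamma_i|\le r\}$. For $S\subseteq\mathbb{Z}^k$, $\rho_r(S)=|S\cap B_r|/|B_r|$. $\zeta$ is the Riemann zeta function, $\zeta(t)=\sum_{n\ge1}n^{-t}$. *)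

(* Defs.v *)
From HB Require Import structures.
From mathcomp Require Import all_boot all_order all_algebra.
From mathcomp Require Import finmap.
From mathcomp Require Import all_classical all_reals all_analysis.

Set Implicit Arguments.
Unset Strict Implicit.
Unset Printing Implicit Defensive.

Import Order.TTheory GRing.Theory Num.Theory.
Import numFieldNormedType.Exports.

Local Open Scope classical_set_scope.
Local Open Scope ring_scope.

(* Z^k is rendered as the type 'rV[int]_k of integer row vectors. *)

Definition tuple_gcd (k : nat) (x : 'rV[int]_k) : nat :=
  \big[gcdn/0%N]_(i < k) `|x ord0 i|%N.

Definition primitive_set (k g : nat) : set 'rV[int]_k :=
  [set x | x != 0 /\ tuple_gcd x = g].
Arguments primitive_set : clear implicits.

Definition box (k r : nat) : set 'rV[int]_k :=
  [set x | (\max_(i < k) `|x ord0 i| <= r)%N].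
Arguments box : clear implicits.

(* [fset_set] is the empty set on infinite sets; this lemma ensures that the
   cardinals in [rho] below are the genuine ones. *)
Lemma finite_box (k r : nat) : finite_set (box k r).
Proof.
pose f (u : 'rV['I_(r.*2.+1)]_k) : 'rV[int]_k :=
  \row_i ((u ord0 i : nat)%:Z - r%:Z).
apply: (@sub_finite_set _ _ (f @` setT)); last first.
  by apply: finite_image; exact: finite_finset.
move=> x /= /bigmax_leqP xr.
exists (\row_i inord (absz (x ord0 i + r%:Z))) => //.
apply/matrixP => o i; rewrite !mxE (ord1 o).
have : `|x ord0 i| <= r%:Z by rewrite -abszE lez_nat; exact: xr.
rewrite ler_norml => /andP[h1 h2].
have h3 : 0 <= x ord0 i + r%:Z by rewrite -lerBlDr sub0r.
rewrite inordK; first by rewrite gez0_abs// addrK.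
by rewrite ltnS -lez_nat gez0_abs// -addnn PoszD lerD2r.
Qed.

Definition rho (R : realType) (k r : nat) (S : set 'rV[int]_k) : R :=
  #|` fset_set (S `&` box k r)|%:R / #|` fset_set (box k r)|%:R.
Arguments rho R {k} r S.

(* [riemannR t n] is [1 / n.+1 `^ t], so this is the series over n >= 1. *)
Definition zeta (R : realType) (t : R) : R := limn (series (riemannR t)).

(* Main.v *)
Require Import Defs.
From HB Require Import structures.
From mathcomp Require Import all_boot all_order all_algebra.
From mathcomp Require Import finmap ring lra zify.
From mathcomp Require Import all_classical all_reals all_analysis.

Import Order.TTheory GRing.Theory Num.Theory.
Import numFieldNormedType.Exports.

Local Open Scope classical_set_scope.
Local Open Scope ring_scope.

(* Let [N m] be the number of 1-primitive points in [B_m].  Scaling by [g] shows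
   that [B_r] contains [N (r %/ g)] points of [P_{k,g}], and sorting the nonzero
   points of [B_m] by gcd gives [\sum_(1 <= d <= m) N (m %/ d) = (2m+1)^k - 1].
   Instead of inverting this by Moebius, put [a m = N m - (2m)^k / zeta k].
   Then [\sum_(1 <= d <= m) a (m %/ d) = o(m^k)], and isolating the term [d = 1]
   turns a bound [|a m| <= B m^k + O(1)] into one with constant [7/8 B], because
   [\sum_(d >= 2) d^-k = zeta k - 1 <= 3/4]; hence [a m = o(m^k)].  Finally,
   with [x = g / (2r+1)], the error [g^k rho_r(P_{k,g}) - 1 / zeta k] is
   [a (r %/ g) * x^k + O(x)], which is at most [g (eps + O(1 / r))]. *)

(** * Boxes and gcds of integer tuples *)

Lemma boxP k r (x : 'rV[int]_k) : box k r x <-> forall i, (`|x ord0 i| <= r)%N.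
Proof.
split=> [/bigmax_leqP xr i|xr]; first exact: xr.
by apply/bigmax_leqP => i _; exact: xr.
Qed.

Lemma dvdn_tuple_gcd k (x : 'rV[int]_k) i : (tuple_gcd x %| `|x ord0 i|)%N.
Proof. exact: biggcdn_inf (dvdnn _). Qed.

Lemma tuple_gcdZ k g (x : 'rV[int]_k) :
  tuple_gcd (g%:Z *: x) = (g * tuple_gcd x)%N.
Proof.
rewrite /tuple_gcd (big_morph (muln g) (muln_gcdr g) (muln0 g)).
by apply: eq_bigr => i _; rewrite mxE abszM.
Qed.

Lemma tuple_gcd_eq0 k (x : 'rV[int]_k) : (tuple_gcd x == 0%N) = (x == 0).
Proof.
apply/eqP/eqP => [g0|->].
  apply/rowP => i; rewrite mxE; apply/eqP.
  by rewrite -absz_eq0 -dvd0n; have := dvdn_tuple_gcd k x i; rewrite g0.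
by apply: big1_seq => i _; rewrite mxE.
Qed.

Lemma primitive_setE k g (x : 'rV[int]_k) :
  (0 < g)%N -> primitive_set k g x <-> tuple_gcd x = g.
Proof.
move=> g0; split=> [[]//|xg]; split=> //.
by rewrite -tuple_gcd_eq0 xg -lt0n.
Qed.

(** The gcd divides some nonzero coordinate, whose size is at most [r]; the origin has gcd 0. *)
Lemma tuple_gcd_le k r (x : 'rV[int]_k) : box k r x -> (tuple_gcd x <= r)%N.
Proof.
move=> /boxP xr; have [->|x0] := eqVneq x 0.
  by rewrite (eqP (_ : tuple_gcd 0 == 0%N)) // tuple_gcd_eq0.
have [i xi0] : exists i, x ord0 i != 0.
  apply: contrapT => /forallNP x0'; move/eqP: x0; apply; apply/rowP => i.
  by rewrite mxE; apply/eqP/negPn/negP/x0'.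
apply: leq_trans (xr i); apply: dvdn_leq (dvdn_tuple_gcd _ _ _).
by rewrite lt0n absz_eq0.
Qed.

(** * Counting lattice points in boxes *)

Lemma card_fset_setT (T : finType) : #|` fset_set [set: T]| = #|T|.
Proof.
rewrite cardE; apply/perm_size/uniq_perm; rewrite ?fset_uniq ?enum_uniq//.
move=> x; rewrite in_fset_set; last exact: finite_finset.
by rewrite mem_enum mem_set.
Qed.

Lemma card_fset_set_image (T U : choiceType) (f : T -> U) (A : set T) :
  finite_set A -> injective f -> #|` fset_set (f @` A)| = #|` fset_set A|.
Proof. by move=> Af f_inj; rewrite fset_set_image// card_imfset. Qed.

(** Adding [r] to every coordinate identifies the box with the [k]-tuples over [{0, ..., 2r}]. *)
Lemma card_box k r : #|` fset_set (box k r)| = (r.*2.+1 ^ k)%N.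
Proof.
pose f (u : 'rV['I_(r.*2.+1)]_k) : 'rV[int]_k :=
  \row_i ((u ord0 i : nat)%:Z - r%:Z).
have f_inj : injective f.
  move=> u v /rowP uv; apply/rowP => i; apply/val_inj.
  by have := uv i; rewrite !mxE => /addIr[].
have -> : box k r = f @` setT.
  apply/seteqP; split=> [x /boxP xr|x [u _ <-]].
    exists (\row_i inord (absz (x ord0 i + r%:Z))) => //.
    apply/rowP => i; rewrite !mxE; have := xr i; move: (x ord0 i) => z zr.
    by rewrite inordK; lia.
  by apply/boxP => i; rewrite mxE; have := ltn_ord (u ord0 i); lia.
rewrite card_fset_set_image//; last exact: finite_finset.
by rewrite card_fset_setT card_mx card_ord mul1n.
Qed.

Definition primitive_count k m : nat :=
  #|` fset_set (primitive_set k 1 `&` box k m)|.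

(** Division by [g] turns gcd [g] into gcd 1, and [|g y_i| <= r] means [|y_i| <= r %/ g]. *)
Lemma primitive_boxE k g r : (0 < g)%N ->
  primitive_set k g `&` box k r =
  ( GRing.scale g%:Z) @` (primitive_set k 1 `&` box k (r %/ g)).
Proof.
move=> g0; apply/seteqP; split=> [x []|x [y []]].
  move=> /(primitive_setE _ _ _ g0) xg /boxP xr.
  have gx i : (g%:Z %| x ord0 i)%Z by rewrite dvdzE -xg dvdn_tuple_gcd.
  have xE : g%:Z *: (\row_i (x ord0 i %/ g%:Z)%Z) = x.
    by apply/rowP => i; rewrite !mxE mulrC divzK.
  exists (\row_i (x ord0 i %/ g%:Z)%Z) => //; split.
    apply/primitive_setE => //; apply/eqP; rewrite -(eqn_pmul2l g0) muln1.
    by rewrite -tuple_gcdZ xE xg.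
  apply/boxP => i; rewrite leq_divRL// mulnC -[g in (g * _)%N]/(absz g%:Z).
  by rewrite -abszM mxE mulrC divzK.
move=> /primitive_setE yg /boxP yr <-; split.
  by apply/primitive_setE => //; rewrite tuple_gcdZ yg ?muln1.
by apply/boxP => i; rewrite mxE abszM mulnC -leq_divRL.
Qed.

Lemma card_primitive_box k g r : (0 < g)%N ->
  #|` fset_set (primitive_set k g `&` box k r)| = primitive_count k (r %/ g).
Proof.
move=> g0; rewrite primitive_boxE// card_fset_set_image//.
  by apply: finite_setIr; exact: finite_box.
move=> u v /rowP uv; apply/rowP => i; have := uv i; rewrite !mxE.
by apply: mulfI; rewrite -lt0n.
Qed.

Lemma primitive_count0 k : primitive_count k 0 = 0%N.
Proof.
rewrite /primitive_count (_ : _ `&` _ = set0) ?fset_set0 ?cardfs0//.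
apply/seteqP; split=> // x [/primitive_setE xg /tuple_gcd_le].
by rewrite xg.
Qed.

Lemma sum_primitive_count k m :
  (\sum_(1 <= d < m.+1) primitive_count k (m %/ d)).+1 = (m.*2.+1 ^ k)%N.
Proof.
pose F d := [set x : 'rV[int]_k | tuple_gcd x = d] `&` box k m.
have F_fin d : finite_set (F d) by apply: finite_setIr; exact: finite_box.
have F_triv : trivIset setT F by move=> i j _ _ [x [[<- _] [<- _]]].
rewrite -card_box (_ : box k m = \big[setU/set0]_(d < m.+1) F d); last first.
  rewrite -bigcup_mkord; apply/seteqP; split=> [x xm|x [d _ []]//].
  by exists (tuple_gcd x) => //=; rewrite ltnS tuple_gcd_le.
(* The class of gcd 0 is the origin alone; it accounts for the successor in the statement. *)
rewrite -trivIset_sum_card// big_ord_recl/= (_ : F 0%N = [set 0]); last first.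
  apply/seteqP; split=> [x [/eqP + _]|x ->].
    by rewrite tuple_gcd_eq0 => /eqP.
  split; first by apply/eqP; rewrite tuple_gcd_eq0.
  by apply/boxP => i; rewrite mxE.
rewrite fset_set1 cardfs1 big_add1 big_mkord; congr (_.+1).
apply: eq_bigr => d _; rewrite -card_primitive_box//.
congr (#|` fset_set _|); apply/seteqP; split=> x [xd xm]; split=> //.
  exact/(primitive_setE _ _ _ (ltn0Sn d)).
exact/(primitive_setE _ _ _ (ltn0Sn d)).
Qed.

Lemma rho_primitive (R : realType) k r g : (0 < g)%N ->
  rho R r (primitive_set k g) =
  (primitive_count k (r %/ g))%:R / (r.*2.+1)%:R ^+ k.
Proof. by move=> g0; rewrite /rho card_primitive_box// card_box natrX. Qed.

(** * Bounds on differences of powers and on zeta *)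

(** [a^k - b^k] is [a - b] times a sum of [k] products [a^(k-1-i) b^i], each at most [a^(k-1)]. *)
Lemma ler_subXn (R : realType) k (a b : R) :
  0 <= b <= a -> a ^+ k - b ^+ k <= k%:R * (a - b) * a ^+ k.-1.
Proof.
move=> /andP[b0 ba]; rewrite subrXX [k%:R * _]mulrC -mulrA.
rewrite ler_wpM2l ?subr_ge0//.
apply: (@le_trans _ _ (\sum_(i < k) a ^+ k.-1)); last first.
  by rewrite sumr_const card_ord mulr_natl.
apply: ler_sum => i _; rewrite -[in leRHS](@subnK i k.-1); last first.
  by have := ltn_ord i; lia.
rewrite exprD ler_wpM2l ?exprn_ge0 ?(le_trans b0)//.
by rewrite lerXn2r ?nnegrE ?(le_trans b0).
Qed.

Lemma series_riemannRE (R : realType) k m :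
  series (riemannR (k%:R : R)) m = \sum_(1 <= d < m.+1) d%:R ^- k.
Proof.
rewrite big_add1; apply: eq_bigr => i _.
by rewrite /riemannR powR_mulrn.
Qed.

(** Telescoping: [1/(n+1)^k <= 1/(n(n+1)) = 1/n - 1/(n+1)]. *)
Lemma series_riemannR_tail (R : realType) k m n :
  (2 <= k)%N -> (0 < m <= n)%N ->
  series (riemannR (k%:R : R)) n <=
  series (riemannR (k%:R : R)) m + m%:R^-1 - n%:R^-1.
Proof.
move=> k2 /andP[m0]; elim: n => [|n IHn]; first by lia.
rewrite leq_eqVlt => /predU1P[->|]; first by rewrite addrK.
rewrite ltnS => mn; rewrite series_riemannRE big_nat_recr//= -series_riemannRE.
have n0 : 0 < n%:R :> R by rewrite ltr0n (leq_trans m0).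
apply: (@le_trans _ _
  (series (riemannR (k%:R : R)) n + (n%:R^-1 - n.+1%:R^-1))).
  rewrite lerD2l; apply: (@le_trans _ _ (n.+1%:R ^- 2)).
    by rewrite lef_pV2 ?posrE ?exprn_gt0// ler_weXn2l// ler1n.
  rewrite -natr1.
  have -> : n%:R^-1 - (n%:R + 1)^-1 = (n%:R * (n%:R + 1))^-1 :> R.
    by field; rewrite !lt0r_neq0// addr_gt0.
  rewrite lef_pV2 ?posrE ?exprn_gt0 ?mulr_gt0 ?addr_gt0//.
  by rewrite expr2 ler_wpM2r ?lerDl ?addr_ge0// ltW.
by rewrite addrA lerD2r -lerBrDr; exact: IHn.
Qed.

Lemma nondecreasing_series_riemannR (R : realType) k :
  nondecreasing_seq (series (riemannR (k%:R : R))).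
Proof.
apply/nondecreasing_seqP => n; rewrite !series_riemannRE [leRHS]big_nat_recr//=.
by rewrite lerDl invr_ge0 exprn_ge0.
Qed.

Lemma is_cvg_riemannR (R : realType) k :
  (2 <= k)%N -> cvgn (series (riemannR (k%:R : R))).
Proof.
move=> k2; apply: nondecreasing_is_cvgn.
  exact: nondecreasing_series_riemannR.
exists (series (riemannR (k%:R : R)) 1 + 1) => _ [n _ <-].
apply: (@le_trans _ _ (series (riemannR (k%:R : R)) n.+1)).
  exact: nondecreasing_series_riemannR.
apply: le_trans (@series_riemannR_tail R k 1 n.+1 k2 _) _ => //.
by rewrite invr1 lerBlDr lerDl invr_ge0.
Qed.

Lemma series_le_zeta (R : realType) k m :
  (2 <= k)%N -> series (riemannR (k%:R : R)) m <= zeta k%:R.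
Proof.
move=> k2; apply: nondecreasing_cvgn_le; last exact: is_cvg_riemannR.
exact: nondecreasing_series_riemannR.
Qed.

Lemma zeta_le_series (R : realType) k m :
  (2 <= k)%N -> (0 < m)%N ->
  zeta k%:R <= series (riemannR (k%:R : R)) m + m%:R^-1.
Proof.
move=> k2 m0; apply: limr_le; first exact: is_cvg_riemannR.
exists m => // n /= mn.
apply: le_trans (@series_riemannR_tail R k m n k2 _) _; first by rewrite m0.
by rewrite lerBlDr lerDl invr_ge0.
Qed.

Lemma zeta_ge1 (R : realType) k : (2 <= k)%N -> 1 <= zeta (k%:R : R).
Proof.
move=> k2; apply: le_trans (series_le_zeta _ _ 1 k2).
by rewrite series_riemannRE big_nat1 expr1n invr1.
Qed.

(** Cutting the series after two terms gives the bound [1 + 2^-k + 1/2], and [2^-k <= 1/4]. *)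
Lemma zeta_le74 (R : realType) k : (2 <= k)%N -> zeta (k%:R : R) <= 7 / 4.
Proof.
move=> k2; apply: le_trans (zeta_le_series R k 2 k2 _) _ => //.
rewrite series_riemannRE big_nat_recr//= big_nat1 expr1n invr1.
have : 2 ^- k <= 2 ^- 2 :> R.
  by rewrite lef_pV2 ?posrE ?exprn_gt0// ler_weXn2l// ler1n.
lra.
Qed.

(** * Harmonic sums and sums of powers of floors *)

(** Serves in place of a logarithmic bound: as [del] is arbitrary, the harmonic sum is [o(m)]. *)
Lemma harmonic_sum_le (R : realType) m (del : R) : 0 < del ->
  \sum_(1 <= d < m.+1) d%:R^-1 <= del * m%:R + del^-1.
Proof.
move=> del0.
have d'0 : 0 < del^-1 by rewrite invr_gt0.
have dd' : del * del^-1 = 1 by rewrite divff// lt0r_neq0.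
(* AM-GM: [1 / d <= del + 1 / (4 del d^2)] *)
apply: (@le_trans _ _
  (\sum_(1 <= d < m.+1) (del + del^-1 / 4 * d%:R ^- 2))).
  apply: ler_sum => d _; rewrite -exprVn; set x := d%:R^-1.
  have : 0 <= del^-1 * (x / 2 - del) ^+ 2 by rewrite mulr_ge0 ?sqr_ge0 ?ltW.
  have -> : del^-1 * (x / 2 - del) ^+ 2 = del^-1 / 4 * x ^+ 2 - x + del.
    by field; rewrite lt0r_neq0.
  lra.
rewrite big_split/= sumr_const_nat subn1/= mulr_natr lerD2l -mulr_sumr.
rewrite -(series_riemannRE R 2).
have := series_le_zeta R 2 m isT; have := zeta_le74 R 2 isT.
set s := series _ _; set z := zeta _ => z74 sz.
have : del^-1 / 4 * s <= del^-1 / 4 * (7 / 4).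
  by rewrite ler_wpM2l ?divr_ge0// ?(le_trans sz)// ltW.
lra.
Qed.

Lemma natr_divn_le (R : realType) m d : (m %/ d)%:R <= m%:R / d%:R :> R.
Proof.
have [->|d0] := posnP d; first by rewrite divn0 invr0 mulr0.
by rewrite ler_pdivlMr ?ltr0n// -natrM ler_nat leq_trunc_div.
Qed.

Lemma natr_divn_ge (R : realType) m d :
  (0 < d)%N -> m%:R / d%:R - 1 <= (m %/ d)%:R :> R.
Proof.
move=> d0; rewrite lerBlDr ler_pdivrMr ?ltr0n// natr1 -natrM ler_nat.
by rewrite ltnW// ltn_ceil.
Qed.

Lemma sum_divnX_le (R : realType) k m : (2 <= k)%N ->
  \sum_(1 <= d < m.+1) (m %/ d)%:R ^+ k <= m%:R ^+ k * zeta (k%:R : R).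
Proof.
move=> k2; apply: (@le_trans _ _ (m%:R ^+ k * series (riemannR (k%:R : R)) m)).
  rewrite series_riemannRE mulr_sumr; apply: ler_sum => d _.
  by rewrite -expr_div_n lerXn2r ?nnegrE ?divr_ge0// natr_divn_le.
by rewrite ler_wpM2l ?exprn_ge0 ?series_le_zeta.
Qed.

(** Two losses are subtracted: cutting zeta at [m] costs [m^(n+1) * 1/m], and replacing [m/d] by its
    floor costs at most [(n+1) (m/d)^n <= (n+1) m^n / d] in each term. *)
Lemma sum_divnX_ge (R : realType) n m : (0 < n)%N -> (0 < m)%N ->
  m%:R ^+ n.+1 * zeta (n.+1%:R : R) - m%:R ^+ n
   - n.+1%:R * m%:R ^+ n * \sum_(1 <= d < m.+1) d%:R^-1 <=
  \sum_(1 <= d < m.+1) (m %/ d)%:R ^+ n.+1.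
Proof.
move=> n0 m0; have mR0 : 0 < m%:R :> R by rewrite ltr0n.
apply: (@le_trans _ _ (\sum_(1 <= d < m.+1)
    (m%:R ^+ n.+1 * d%:R ^- n.+1 - n.+1%:R * m%:R ^+ n * d%:R^-1))).
  rewrite sumrB -!mulr_sumr lerD2r -series_riemannRE lerBlDr.
  have -> : m%:R ^+ n = m%:R ^+ n.+1 * m%:R^-1 :> R.
    by rewrite exprSr mulfK ?lt0r_neq0.
  by rewrite -mulrDr ler_wpM2l ?exprn_ge0// zeta_le_series.
apply: ler_sum_nat => d /andP[d1 _]; rewrite -expr_div_n lerBlDr -lerBlDl.
have dR1 : 1 <= d%:R :> R by rewrite ler1n.
have divP : (0 <= (m %/ d)%:R :> R) && ((m %/ d)%:R <= m%:R / d%:R :> R).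
  by rewrite ler0n natr_divn_le.
apply: le_trans (ler_subXn R n.+1 _ _ divP) _; rewrite -!mulrA ler_wpM2l//=.
rewrite -[leRHS]mul1r; apply: ler_pM.
- by rewrite subr_ge0 natr_divn_le.
- by rewrite exprn_ge0// divr_ge0.
- by rewrite lerBlDr -lerBlDl natr_divn_ge.
rewrite expr_div_n ler_wpM2l ?exprn_ge0//.
rewrite lef_pV2 ?posrE ?exprn_gt0 ?(lt_le_trans ltr01)//.
by rewrite -[leLHS]expr1 ler_weXn2l.
Qed.

(** * Sequences negligible against [m^k] *)

(** For [k > 0] this is [a m = o(m^k)]. The additive constant, which may depend on [eps], replaces a
    threshold on [m], so that the bound also applies to small quotients [m %/ d]. *)
Definition is_little_pow (R : realType) k (a : nat -> R) :=
  forall eps : R, 0 < eps ->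
    exists M, forall m, `|a m| <= eps * m%:R ^+ k + M.

(** Below [1/eps], [m^j] is at most [eps^-j]; above it, [m^j <= eps m^(j+1) <= eps m^k]. *)
Lemma little_pow_lt (R : realType) j k : (j < k)%N ->
  is_little_pow R k (fun m => m%:R ^+ j).
Proof.
move=> jk eps eps0; exists (eps^-1 ^+ j) => m.
have e'0 : 0 < eps^-1 by rewrite invr_gt0.
rewrite ger0_norm ?exprn_ge0//.
have [m_le|m_gt] := leP m%:R eps^-1.
  apply: (@le_trans _ _ (eps^-1 ^+ j)).
    by rewrite lerXn2r ?nnegrE// ltW.
  by rewrite lerDr mulr_ge0 ?exprn_ge0// ltW.
apply: (@le_trans _ _ (eps * m%:R ^+ k)); last first.
  by rewrite lerDl exprn_ge0// ltW.
have m0 : 0 < m%:R :> R by rewrite (lt_trans e'0).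
apply: (@le_trans _ _ (eps * m%:R ^+ j.+1)).
  rewrite exprS mulrA ler_peMl ?exprn_ge0//.
  by rewrite -ler_pdivrMl// mulr1 ltW.
by rewrite ler_wpM2l ?(ltW eps0)// ler_weXn2l// ler1n -(ltr0n R).
Qed.

Lemma little_pow_scale (R : realType) k (C : R) a : is_little_pow R k a ->
  is_little_pow R k (fun m => C * a m).
Proof.
move=> aP eps eps0; have C0 : 0 < `|C| + 1 by rewrite ltr_wpDl.
have [M aM] := aP (eps / (`|C| + 1)) (divr_gt0 eps0 C0).
exists ((`|C| + 1) * M) => m; rewrite normrM.
apply: (@le_trans _ _ ((`|C| + 1) * `|a m|)).
  by rewrite ler_wpM2r// lerDl.
apply: le_trans (ler_wpM2l (ltW C0) (aM m)) _.
by rewrite mulrDr mulrA mulrCA divff ?lt0r_neq0// mulr1.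
Qed.

Lemma little_pow_add (R : realType) k a b :
  is_little_pow R k a -> is_little_pow R k b ->
  is_little_pow R k (fun m => a m + b m).
Proof.
move=> aP bP eps eps0; have eps2 : 0 < eps / 2 by rewrite divr_gt0.
have [M aM] := aP _ eps2; have [M' bM'] := bP _ eps2.
exists (M + M') => m; apply: le_trans (ler_normD _ _) _.
have := aM m; have := bM' m; move: (m%:R ^+ k) => t.
lra.
Qed.

Lemma little_pow_le (R : realType) k (a b : nat -> R) :
  (forall m, `|a m| <= b m) -> is_little_pow R k b -> is_little_pow R k a.
Proof.
move=> ab bP eps eps0; have [M bM] := bP _ eps0; exists M => m.
apply: le_trans (ab m) _; apply: le_trans (bM m); exact: ler_norm.
Qed.

(** The harmonic bound with [del = eps/2] leaves [(eps/2) m^(n+1)] plus a constant times [m^n], and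
    the latter is again negligible. *)
Lemma little_pow_harmonic (R : realType) n :
  is_little_pow R n.+1
    (fun m => m%:R ^+ n * \sum_(1 <= d < m.+1) d%:R^-1).
Proof.
move=> eps eps0; have eps2 : 0 < eps / 2 by rewrite divr_gt0.
have [M MP] := little_pow_scale R n.+1 (eps / 2)^-1 _
  (little_pow_lt R n n.+1 (ltnSn n)) _ eps2.
exists M => m; have := MP m; set H := \sum_(_ <= _ < _) _.
have H0 : 0 <= H by apply: sumr_ge0 => d _; rewrite invr_ge0.
have e'0 : 0 <= (eps / 2)^-1 by rewrite invr_ge0 ltW.
rewrite !ger0_norm ?mulr_ge0 ?exprn_ge0// => {}MP.
have Hm := harmonic_sum_le R m _ eps2.
apply: le_trans (ler_wpM2l (exprn_ge0 n (ler0n R m)) Hm) _.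
move: MP; rewrite exprS; move: (m%:R ^+ n) (eps / 2)^-1 => t e' MP.
move: (m%:R) MP => x MP.
rewrite mulrDr [t * e']mulrC mulrCA [t * x]mulrC; lra.
Qed.

(* The hypothesis reads [a m = - \sum_(2 <= d <= m) a (m %/ d)] up to a
   negligible term; since [zeta k - 1 <= 3/4 < 1], a bound [|a m| <= B m^k]
   improves to [|a m| <= (7/8) B m^k]. *)
Lemma little_pow_step (R : realType) k (a : nat -> R) (B : R) :
  (2 <= k)%N -> 0 < B ->
  is_little_pow R k (fun m => \sum_(1 <= d < m.+1) a (m %/ d)%N) ->
  (exists M, forall m, `|a m| <= B * m%:R ^+ k + M) ->
  exists M, forall m, `|a m| <= 7 / 8 * B * m%:R ^+ k + M.
Proof.
move=> k2 B0 EP [M aM].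
have M0 : 0 <= M.
  have := aM 0%N; rewrite expr0n gtn_eqF ?mulr0 ?add0r; last by lia.
  by apply: le_trans.
(* The budget is [3/4 + 1/16 + 1/16 = 7/8]: the terms [d >= 2], the divisor sum itself, and the
   accumulated constants [M * m]. *)
have B16 : 0 < B / 16 by rewrite divr_gt0.
have [M1 EM1] := EP _ B16.
have [M2 MM2] := little_pow_scale R k M _ (little_pow_lt R 1 k k2) _ B16.
have MB0 m : 0 <= B / 16 * m%:R ^+ k by rewrite mulr_ge0 ?exprn_ge0// ltW.
exists (M + M1 + M2) => m.
have /= := MM2 m; rewrite expr1 ger0_norm ?mulr_ge0// => MmM2.
have := EM1 m.
(* For [m = 0] the divisor sum is empty and has no term [d = 1] to isolate; there [aM] gives
   [|a 0| <= M]. *)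
have [m0|m0] := posnP m.
  have := aM m; rewrite m0 big_geq// normr0 in MmM2 *; move: MmM2.
  by rewrite mulr0 expr0n gtn_eqF ?mulr0 ?add0r; [lra|lia].
rewrite big_ltn// divn1; set S := \sum_(_ <= _ < _) _ => E.
have S_le : `|S| <= B * m%:R ^+ k * (3 / 4) + M * m%:R.
  apply: (@le_trans _ _ (\sum_(2 <= d < m.+1) (B * m%:R ^+ k * d%:R ^- k + M))).
    apply: le_trans (ler_norm_sum _ _ _) _; apply: ler_sum => d _.
    apply: le_trans (aM _) _; rewrite lerD2r -mulrA ler_wpM2l ?(ltW B0)//.
    by rewrite -expr_div_n lerXn2r ?nnegrE ?divr_ge0// natr_divn_le.
  rewrite big_split/= -mulr_sumr; apply: lerD.
    rewrite ler_wpM2l ?mulr_ge0 ?exprn_ge0 ?(ltW B0)//.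
    have := le_trans (series_le_zeta R k m k2) (zeta_le74 R k k2).
    by rewrite series_riemannRE big_ltn// expr1n invr1; lra.
  by rewrite sumr_const_nat -[M *+ _]mulr_natr ler_wpM2l// ler_nat; lia.
have -> : a m = (a m + S) - S by rewrite addrK.
apply: le_trans (ler_normB _ _) _.
move: S_le E MmM2; move: (m%:R ^+ k) => t; lra.
Qed.

(** Iterating the contraction brings the constant down to [(7/8)^j B], below any [eps]. The additive
    constant may change with [j], which is harmless because [j] is fixed once [eps] is. *)
Lemma little_pow_of_divisor_sums (R : realType) k (a : nat -> R) (B : R) :
  (2 <= k)%N -> 0 < B ->
  is_little_pow R k (fun m => \sum_(1 <= d < m.+1) a (m %/ d)%N) ->
  (forall m, `|a m| <= B * m%:R ^+ k + B) ->
  is_little_pow R k a.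
Proof.
move=> k2 B0 EP aB eps eps0.
have step j : exists M, forall m, `|a m| <= (7 / 8) ^+ j * B * m%:R ^+ k + M.
  elim: j => [|j IHj]; first by exists B => m; rewrite expr0 mul1r.
  rewrite exprS -[_ * _ * B]mulrA; apply: little_pow_step => //.
  by rewrite mulr_gt0// exprn_gt0.
have /cvgrPdist_lt : (7 / 8 : R) ^+ j @[j --> \oo] --> 0.
  by apply: cvg_expr; rewrite ger0_norm; lra.
move=> /(_ (eps / B) (divr_gt0 eps0 B0))[j _ /(_ j (leqnn j))].
rewrite /= sub0r normrN ger0_norm ?exprn_ge0// ltr_pdivlMr// => jB.
have [M aM] := step j; exists M => m; apply: le_trans (aM m) _.
by rewrite lerD2r ler_wpM2r ?exprn_ge0// ltW.
Qed.

(** * Asymptotics of the number of primitive points *)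

Lemma primitive_count_le k m : (primitive_count k m <= m.*2.+1 ^ k)%N.
Proof.
rewrite -card_box; apply: fsubset_leq_card.
rewrite -fset_set_sub; first by move=> x [].
  by apply: finite_setIr; exact: finite_box.
exact: finite_box.
Qed.

Lemma natr_doubleS_le (R : realType) m : (0 < m)%N ->
  m.*2.+1%:R <= 3 * m%:R :> R.
Proof. by move=> m0; rewrite -natrM ler_nat; lia. Qed.

(** The counts sum to [(2m+1)^k - 1], and the floor powers, scaled by [2^k / zeta k], sum to
    [(2m)^k] up to lower order; the main terms cancel. *)
Lemma little_pow_primitive_count_sum (R : realType) n : (0 < n)%N ->
  is_little_pow R n.+1 (fun m => \sum_(1 <= d < m.+1)
    ((primitive_count n.+1 (m %/ d))%:R
      - (2 * (m %/ d)%:R) ^+ n.+1 / zeta (n.+1%:R : R))).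
Proof.
(* In [C], the first summand bounds [(2m+1)^k - (2m)^k] through [2m+1 <= 3m], and the second comes
   from cutting zeta at [m]; [C'] comes from the floors. *)
move=> n0; set z := zeta _; set C := n.+1%:R * 3 ^+ n + 2 ^+ n.+1 : R.
set C' := 2 ^+ n.+1 * n.+1%:R : R.
have z1 : 1 <= z by exact: zeta_ge1.
have z0 : 0 < z by rewrite (lt_le_trans ltr01).
apply: (little_pow_le _ _ _ (fun m =>
    C * m%:R ^+ n + C' * (m%:R ^+ n * \sum_(1 <= d < m.+1) d%:R^-1))).
  move=> m; have [->|m0] := posnP m.
    by rewrite !big_geq// normr0 expr0n gtn_eqF// !mul0r !mulr0 addr0.
  rewrite sumrB; under [X in _ - X]eq_bigr do rewrite exprMn mulrAC.
  rewrite -mulr_sumr -natr_sum.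
  have -> : (\sum_(1 <= d < m.+1) primitive_count n.+1 (m %/ d))%:R
      = (2 * m%:R + 1) ^+ n.+1 - 1 :> R.
    apply/eqP; rewrite -subr_eq opprK natr1 sum_primitive_count natrX -natr1.
    by rewrite -mul2n natrM.
  set H := \sum_(_ <= _ < _) _^-1; set X := \sum_(_ <= _ < _) _.
  have X_le : X <= m%:R ^+ n.+1 * z by exact: sum_divnX_le.
  have X_ge := sum_divnX_ge R n m n0 m0.
  rewrite -/X -/z -/H in X_ge.
  have H0 : 0 <= H by apply: sumr_ge0 => d _; rewrite invr_ge0.
  have tn0 : 0 <= m%:R ^+ n :> R by rewrite exprn_ge0.
  (* This strict growth over the naturals absorbs the [- 1] left by the origin, so the difference is
     nonnegative. *)
  have m2 : (2 * m%:R) ^+ n.+1 + 1 <= (2 * m%:R + 1) ^+ n.+1 :> R.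
    rewrite -natrM natr1 -!natrX natr1 ler_nat.
    by rewrite ltn_exp2r.
  have m2' : (2 * m%:R + 1) ^+ n.+1 - (2 * m%:R) ^+ n.+1
      <= n.+1%:R * 3 ^+ n * m%:R ^+ n :> R.
    have /(ler_subXn R n.+1)/le_trans :
      (0 <= 2 * m%:R :> R) && (2 * m%:R <= 2 * m%:R + 1 :> R).
      by rewrite mulr_ge0//= lerDl ler01.
    apply; rewrite addrAC subrr add0r mulr1 -mulrA ler_wpM2l// -exprMn.
    rewrite lerXn2r ?nnegrE ?addr_ge0 ?mulr_ge0//.
    by rewrite -natrM natr1 mul2n natr_doubleS_le.
  have Xz_le : 2 ^+ n.+1 / z * X <= (2 * m%:R) ^+ n.+1.
    rewrite exprMn -[_ / z * _]mulrA ler_wpM2l ?exprn_ge0//.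
    by rewrite ler_pdivrMl// mulrC.
  have Xz_ge : (2 * m%:R) ^+ n.+1 - 2 ^+ n.+1 * m%:R ^+ n
      - C' * (m%:R ^+ n * H) <= 2 ^+ n.+1 / z * X.
    have -> : (2 * m%:R) ^+ n.+1 - 2 ^+ n.+1 * m%:R ^+ n - C' * (m%:R ^+ n * H)
      = 2 ^+ n.+1 * (m%:R ^+ n.+1 - (m%:R ^+ n + n.+1%:R * m%:R ^+ n * H)).
      by rewrite exprMn /C'; ring.
    rewrite -[_ / z * _]mulrA ler_wpM2l ?exprn_ge0// ler_pdivlMl//.
    apply: le_trans X_ge; rewrite mulrBr [z * _]mulrC -addrA -opprD.
    rewrite lerD2l lerN2.
    by rewrite ler_peMl// addr_ge0// !mulr_ge0.
  have CH0 : 0 <= C' * (m%:R ^+ n * H) by rewrite !mulr_ge0 ?exprn_ge0.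
  have Cn0 : 0 <= 2 ^+ n.+1 * m%:R ^+ n :> R by rewrite mulr_ge0 ?exprn_ge0.
  rewrite /C [(_ + _) * m%:R ^+ n]mulrDl ler_norml; apply/andP.
  move: Xz_le Xz_ge m2 m2' CH0 Cn0.
  move: (2 ^+ n.+1 / z * X) ((2 * m%:R) ^+ n.+1) (2 ^+ n.+1 * m%:R ^+ n).
  move: (C' * _) ((2 * m%:R + 1) ^+ n.+1) (n.+1%:R * 3 ^+ n * m%:R ^+ n).
  by move=> *; split; lra.
apply: little_pow_add; apply: little_pow_scale; first exact: little_pow_lt.
exact: little_pow_harmonic.
Qed.

(** The a priori bound that starts the iteration is crude: both terms lie between 0 and [(2m+1)^k],
    which is at most [3^k m^k + 3^k]. *)
Lemma little_pow_primitive_count (R : realType) k : (2 <= k)%N ->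
  is_little_pow R k (fun m => (primitive_count k m)%:R
      - (2 * m%:R) ^+ k / zeta (k%:R : R)).
Proof.
case: k => // n n0; set z := zeta _.
have z1 : 1 <= z by exact: zeta_ge1.
have z0 : 0 < z by rewrite (lt_le_trans ltr01).
apply: (little_pow_of_divisor_sums R n.+1 _ (2 * 3 ^+ n.+1)) => //.
  exact: little_pow_primitive_count_sum.
move=> m.
have m3 : m.*2.+1%:R ^+ n.+1 <= 3 ^+ n.+1 * m%:R ^+ n.+1 + 3 ^+ n.+1 :> R.
  have [->|m0] := posnP m.
    by rewrite expr0n mulr0 add0r expr1n exprn_ege1// ler1n.
  rewrite -exprMn (@le_trans _ _ ((3 * m%:R) ^+ n.+1)) ?lerDl ?exprn_ge0//.
  by rewrite lerXn2r ?nnegrE ?mulr_ge0// natr_doubleS_le.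
have pc : (primitive_count n.+1 m)%:R <= m.*2.+1%:R ^+ n.+1 :> R.
  by rewrite -natrX ler_nat primitive_count_le.
have zm : (2 * m%:R) ^+ n.+1 / z <= m.*2.+1%:R ^+ n.+1.
  rewrite ler_pdivrMr// (@le_trans _ _ (m.*2.+1%:R ^+ n.+1))//.
    by rewrite -natrM -!natrX ler_nat leq_exp2r//; lia.
  by rewrite ler_peMr ?exprn_ge0.
have zm0 : 0 <= (2 * m%:R) ^+ n.+1 / z.
  by rewrite divr_ge0 ?exprn_ge0 ?mulr_ge0// ltW.
rewrite ler_norml; have : 0 <= (primitive_count n.+1 m)%:R :> R by [].
by lra.
Qed.

(** * From counts to densities *)

(** With [y = 2mg/(2r+1)], the error times [g^k] is [D x^k + (y^k - 1)/z]. Each part is controlled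
    because [x], [m x] and [y] lie in [[0, 1]] and [1 - y = O(x)]. *)
Lemma rho_primitive_dist (R : realType) k (eps : R) : (2 <= k)%N -> 0 < eps ->
  exists M : R, 0 <= M /\ forall r g : nat, (1 <= g <= r)%N ->
    `|rho R r (primitive_set k g) - 1 / (g%:R ^+ k * zeta (k%:R : R))|
      <= (eps + M / r.*2.+1%:R) / g%:R ^+ (k - 1).
Proof.
move=> k2 eps0; set z := zeta _.
have z1 : 1 <= z by exact: zeta_ge1.
have z0 : 0 < z by rewrite (lt_le_trans ltr01).
have [M DM] := little_pow_primitive_count R k k2 eps eps0.
have M0 : 0 <= M.
  have := DM 0%N; rewrite [0%:R ^+ k]expr0n gtn_eqF ?mulr0 ?add0r; last by lia.
  by apply: le_trans.
exists (M + 3 * k%:R); split=> [|r g /andP[g1 gr]].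
  by rewrite addr_ge0// mulr_ge0.
set N := r.*2.+1%:R; set m := (r %/ g)%N.
have N0 : 0 < N by rewrite ltr0n.
have gR1 : 1 <= g%:R :> R by rewrite ler1n.
have g0 : 0 < g%:R :> R by rewrite (lt_le_trans ltr01).
pose x : R := g%:R / N; pose y : R := 2 * m%:R * x.
have x0 : 0 <= x by rewrite divr_ge0.
have x1 : x <= 1 by rewrite ler_pdivrMr// mul1r ler_nat; lia.
have mg_le : (m * g <= r)%N by exact: leq_trunc_div.
have mg_gt : (r < m.+1 * g)%N by exact: ltn_ceil.
have y0 : 0 <= y by rewrite /y; apply: mulr_ge0 => //; apply: mulr_ge0.
have y1 : y <= 1.
  by rewrite /y /x mulrA ler_pdivrMr// mul1r -!natrM ler_nat; lia.
(* Cleared of denominators this is [2r + 1 <= 2mg + 3g], a consequence of [r < (m+1) g]. *)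
have y1x : 1 - y <= 3 * x.
  rewrite /y /x !mulrA -{1}(divff (lt0r_neq0 N0)) -mulrBl ler_pM2r ?invr_gt0//.
  rewrite lerBlDr -!natrM -natrD ler_nat; nia.
have mx0 : 0 <= m%:R * x by exact: mulr_ge0.
have mx1 : m%:R * x <= 1.
  by move: y1; rewrite /y -mulrA; lra.
set D := (primitive_count k m)%:R - (2 * m%:R) ^+ k / z.
have Dx : `|D * x ^+ k| <= eps + M * x.
  rewrite normrM (ger0_norm (exprn_ge0 k x0)).
  apply: le_trans (ler_wpM2r (exprn_ge0 k x0) (DM m)) _.
  rewrite mulrDl -mulrA -exprMn; apply: lerD.
    by rewrite ler_piMr ?(ltW eps0)// exprn_ile1.
  rewrite ler_wpM2l//; case: (k) k2 => // k' _.
  by rewrite exprS ler_piMr// exprn_ile1.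
have yk : `|(y ^+ k - 1) / z| <= 3 * k%:R * x.
  rewrite normrM distrC (@ger0_norm _ (1 - _)) ?subr_ge0 ?exprn_ile1//.
  rewrite (@ger0_norm _ z^-1) ?invr_ge0 ?(ltW z0)// ler_pdivrMr//.
  apply: (@le_trans _ _ (3 * k%:R * x)); last first.
    by rewrite ler_peMr// mulr_ge0// mulr_ge0.
  have /(ler_subXn R k) : (0 <= y) && (y <= 1) by rewrite y0.
  rewrite !expr1n mulr1 => /le_trans; apply.
  by rewrite [3 * _]mulrC -mulrA ler_wpM2l.
have gk : g%:R ^+ k = g%:R * g%:R ^+ (k - 1) :> R.
  by rewrite -exprS subn1 prednK// ltnW.
rewrite (rho_primitive R k r g g1).
have -> : (primitive_count k (r %/ g))%:R / r.*2.+1%:R ^+ k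
      - 1 / (g%:R ^+ k * z)
    = (D * x ^+ k + (y ^+ k - 1) / z) / g%:R ^+ k.
  have pcE : (primitive_count k (r %/ g))%:R = D + (2 * m%:R) ^+ k / z.
    by rewrite subrK.
  rewrite pcE /y (exprMn k _ x) /x expr_div_n -/N.
  have gk0 : g%:R ^+ k != 0 :> R by rewrite expf_neq0// lt0r_neq0.
  have Nk0 : N ^+ k != 0 by rewrite expf_neq0// lt0r_neq0.
  move: (D) (g%:R ^+ k) (N ^+ k) ((2 * m%:R) ^+ k) gk0 Nk0 => d a b c a0 b0.
  by field; rewrite a0 b0 lt0r_neq0.
rewrite normrM (@ger0_norm _ (_ ^-1)) ?invr_ge0 ?exprn_ge0//.
(* One factor [g] is spent here: [g / (2r+1)] is [x], and [eps <= g * eps]. *)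
rewrite ler_pdivrMr ?exprn_gt0// gk mulrCA divfK ?expf_neq0 ?lt0r_neq0//.
apply: le_trans (ler_normD _ _) _; apply: le_trans (lerD Dx yk) _.
rewrite mulrDr [g%:R * (_ / N)]mulrCA -/x -addrA -mulrDl lerD2r.
by rewrite ler_peMl// ltW.
Qed.

(** * The weighted bound and uniform convergence *)

Theorem proposition2p5 (R : realType) (k : nat) (hk : (2 <= k)%N) :
  (forall eps : R, 0 < eps ->
     exists r0 : nat, (0 < r0)%N /\
       forall r g : nat, (r0 <= r)%N -> (1 <= g <= r)%N ->
         `|rho R r (primitive_set k g) - 1 / (g%:R ^+ k * zeta (k%:R : R))|
           <= eps / g%:R ^+ (k - 1)) /\
  {uniform [set g : nat | (1 <= g)%N],
     (fun r g : nat => rho R r (primitive_set k g)) @ \oo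
       --> (fun g : nat => 1 / (g%:R ^+ k * zeta (k%:R : R)) : R)}.
Proof.
set P1 := (X in X /\ _).
have part1 : P1.
  move=> eps eps0; have eps2 : 0 < eps / 2 by rewrite divr_gt0.
  have [M [M0 HM]] := rho_primitive_dist R k _ hk eps2.
  (* This makes [M / (eps/2) < r0 <= r <= 2r+1], so the term [M / (2r+1)] is at most [eps/2]. *)
  exists (Num.trunc (M / (eps / 2))).+1; split=> // r g r0r g1r.
  apply: le_trans (HM r g g1r) _.
  rewrite ler_wpM2r ?invr_ge0 ?exprn_ge0// -lerBrDl.
  rewrite (_ : eps - eps / 2 = eps / 2); last by lra.
  rewrite ler_pdivrMr// mulrC -ler_pdivrMr//.
  apply: le_trans (ltW (truncnS_gt _)) _.
  by rewrite ler_nat (leq_trans r0r)//; lia.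
split=> // U /uniform_nbhs[E [entE EU]].
have [eps /= eps0 epsE] : entourage_ (@ball R R) E by rewrite entourage_ballE.
have eps2 : 0 < eps / 2 by rewrite divr_gt0.
have [r0 [_ Hr0]] := part1 _ eps2.
(* The first bound serves [g <= r]. The second serves [g > r], where the density is 0 and
   [1/(g^k zeta k) <= 1/g <= eps/2]. *)
exists (maxn r0 (Num.trunc (eps / 2)^-1).+1) => // r /= rr0.
apply: EU => g /= g1; apply: epsE.
rewrite /= /ball/= distrC.
rewrite (@le_lt_trans _ _ (eps / 2)) ?gtr_pMr ?invf_lt1 ?ltr1n//.
have g0 : 0 < g%:R :> R by rewrite ltr0n.
have gX_ge1 j : 1 <= g%:R ^+ j :> R by rewrite exprn_ege1// ler1n.
have [gr|rg] := leqP g r.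
  apply: le_trans (Hr0 r g _ _) _; [lia|by rewrite g1|].
  by rewrite ler_pdivrMr ?exprn_gt0// ler_peMr// ltW.
have z1 := zeta_ge1 R k hk.
(* As [r < g], the quotient [r %/ g] is 0 and the box of radius 0 has no primitive point. *)
rewrite rho_primitive// divn_small// primitive_count0 mul0r sub0r normrN.
rewrite ger0_norm; last by rewrite divr_ge0// mulr_ge0// (le_trans ler01).
rewrite mul1r -[leRHS]invrK lef_pV2 ?posrE ?invr_gt0//; last first.
  by rewrite mulr_gt0 ?exprn_gt0// (lt_le_trans ltr01).
apply: le_trans (ltW (truncnS_gt _)) _.
apply: (@le_trans _ _ (g%:R ^+ k)); last by rewrite ler_peMr ?exprn_ge0.
apply: (@le_trans _ _ g%:R).
  by rewrite ler_nat (leq_trans _ (ltnW rg))// (leq_trans _ rr0)// leq_maxr.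
by rewrite -[leLHS]expr1 ler_weXn2l ?ler1n// ltnW.
Qed.
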